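(* Let $\mathcal X,\mathcal Y,f,L,L_0,\widehat L,V,q$ be as in the context. For any sample set $Y_N=\{y_1,\ldots,y_N\}\subset\mathcal Y$ with coverage radius $\beta_N=\max_{y\in\mathcal Y}\min_{j\in[N]}\|y-y_j\|$, the function $V_N(x)=\max_{j\in[N]}q(x,y_j)$ satisfies $$0\le V(x)-V_N(x)\le \widehat L\,\beta_N^2,\qquad \forall x\in\mathcal X.$$ Consequently, with $\nu^*=\min_{x\in\mathcal X}V(x)$, $\nu_N^*=\min_{x\in\mathcal X}V_N(x)$, $\mathcal X^*=\arg\min_{x\in\mathcal X}V(x)$ and $\mathcal X_N^*=\arg\min_{x\in\mathcal X}V_N(x)$, $$0\le \nu^*-\nu_N^*\le \widehat L\,\beta_N^2,\qquad\text{and}\qquad d(\mathcal X_N^*,\mathcal X^* )\le \mathcal R^{-1}\big(\widehat L\,\beta_N^2\big).$$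
   Context: $\|\cdot\|$ is the Euclidean norm (operator norm for matrices), $[N]=\{1,\ldots,N\}$. $\mathcal X\subseteq\mathbb R^n$ and $\mathcal Y\subseteq\mathbb R^m$ are nonempty, compact, convex sets. $f$ is a real-valued function, twice continuously differentiable in an open neighborhood of $\mathcal X\times\mathcal Y$, and there are constants $L,L_0>0$ such that for all $(x,y),(x',y')\in\mathcal X\times\mathcal Y$: $\|\nabla f(x,y)-\nabla f(x',y')\|\le L\|(x,y)-(x',y')\|$ and $\|\nabla^2_{xy}f(x,y)-\nabla^2_{xy}f(x',y')\|\le L_0\|(x,y)-(x',y')\|$. Moreover $L$ is chosen large enough that also $\|\nabla f(x,y)\|\le L$ on $\mathcal X\times\mathcal Y$. $\widehat L>L$ is a fixed constant. Define $$V(x)=\max_{y\in\mathcal Y}f(x,y),\qquad q(x,y)=f(x,y)+\max_{z\in\mathcal Y}\Big(\langle\nabla_yf(x,y),z-y\rangle-\tfrac{\widehat L}{2}\|z-y\|^2\Big).$$ For nonempty sets $A,B$, $d(A,B)=\sup_{a\in A}\operatorname{dist}(a,B)$, with $\operatorname{dist}(a,B)=\inf_{b\in B}\|a-b\|$. Growth modulus: for $\tau\ge0$ let $A(\tau)=\{x\in\mathcal X:\operatorname{dist}(x,\mathcal X^* )\ge\tau\}$, and $\mathcal R(\tau)=\inf\{V(x)-\nu^*: x\in A(\tau)\}$ if $A(\tau)\ne\emptyset$, $\mathcal R(\tau)=+\infty$ otherwise. Its generalized inverse is $\mathcal R^{-1}(t)=\sup\{\tau\ge0:\mathcal R(\tau)\le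 t\}$ for $t\ge0$. *)

(* Defs.v *)
(* MathComp-Analysis *)
From HB Require Import structures.
From mathcomp Require Export all_boot all_order all_algebra.
From mathcomp Require Export all_classical all_reals all_analysis.

Set Implicit Arguments.
Unset Strict Implicit.
Unset Printing Implicit Defensive.

Import Order.TTheory GRing.Theory Num.Theory.
Import numFieldNormedType.Exports.

Local Open Scope classical_set_scope.
Local Open Scope ring_scope.

(* R^k is 'rV[R]_k, and (x, y) in R^n x R^m is row_mx x y : 'rV[R]_(n + m).
   The library norm on 'rV[R]_k is the sup norm: it induces the usual topology
   (used for open, compact, continuous, differentiable), but metric quantities
   below use the Euclidean norm. *)

Definition dotp (R : realType) (k : nat) (u v : 'rV[R]_k) : R :=
  \sum_(i < k) u 0 i * v 0 i.

Definition enorm (R : realType) (k : nat) (u : 'rV[R]_k) : R :=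
  Num.sqrt (dotp u u).

(* u *m A^T is A applied to u, vectors being rows. *)
Definition opnorm (R : realType) (n m : nat) (A : 'M[R]_(n, m)) : R :=
  sup [set enorm (u *m A^T) | u in [set u : 'rV[R]_m | enorm u <= 1]].

(* The greatest (least) element of S; the default 0 is taken only when there is
   none, so equalities and bounds involving these have to establish that the
   extremum is attained. *)
Definition maxof (R : realType) (S : set R) : R := xget 0 (S `&` ubound S).
Definition minof (R : realType) (S : set R) : R := xget 0 (S `&` lbound S).

Definition argmin (R : realType) (k : nat) (X : set 'rV[R]_k)
    (g : 'rV[R]_k -> R) : set 'rV[R]_k :=
  [set x | X x /\ forall x', X x' -> g x <= g x'].

Definition partial (R : realType) (k : nat) (i : 'I_k) (f : 'rV[R]_k -> R)
    (z : 'rV[R]_k) : R :=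
  'D_(delta_mx 0 i) f z.

Definition grad (R : realType) (k : nat) (f : 'rV[R]_k -> R) (z : 'rV[R]_k) :
    'rV[R]_k :=
  \row_i partial i f z.

Definition hess (R : realType) (k : nat) (f : 'rV[R]_k -> R) (z : 'rV[R]_k) :
    'M[R]_k :=
  \matrix_(i, j) partial j (partial i f) z.

(* f is twice (Frechet) differentiable on the open set U, with continuous
   second derivative. *)
Definition C2_on (R : realType) (k : nat) (U : set 'rV[R]_k)
    (f : 'rV[R]_k -> R) : Prop :=
  [/\ forall z, U z -> differentiable f z,
      forall i z, U z -> differentiable (partial i f) z
    & forall i j z, U z -> {for z, continuous (partial j (partial i f))}].

Definition grad_y (R : realType) (n m : nat) (f : 'rV[R]_(n + m) -> R)
    (x : 'rV[R]_n) (y : 'rV[R]_m) : 'rV[R]_m :=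
  rsubmx (grad f (row_mx x y)).

Definition hess_xy (R : realType) (n m : nat) (f : 'rV[R]_(n + m) -> R)
    (x : 'rV[R]_n) (y : 'rV[R]_m) : 'M[R]_(n, m) :=
  ursubmx (hess f (row_mx x y)).

Definition value (R : realType) (n m : nat) (f : 'rV[R]_(n + m) -> R)
    (Y : set 'rV[R]_m) (x : 'rV[R]_n) : R :=
  maxof [set f (row_mx x y) | y in Y].

Definition qmodel (R : realType) (n m : nat) (f : 'rV[R]_(n + m) -> R)
    (Y : set 'rV[R]_m) (Lhat : R) (x : 'rV[R]_n) (y : 'rV[R]_m) : R :=
  f (row_mx x y) +
  maxof [set dotp (grad_y f x y) (z - y) - Lhat / 2 * enorm (z - y) ^+ 2
        | z in Y].

Definition sampled_value (R : realType) (n m : nat) (f : 'rV[R]_(n + m) -> R)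
    (Y : set 'rV[R]_m) (Lhat : R) (N : nat) (ys : 'I_N -> 'rV[R]_m)
    (x : 'rV[R]_n) : R :=
  maxof (range (fun j => qmodel f Y Lhat x (ys j))).

Definition coverage_radius (R : realType) (m : nat) (Y : set 'rV[R]_m)
    (N : nat) (ys : 'I_N -> 'rV[R]_m) : R :=
  maxof [set minof (range (fun j => enorm (y - ys j))) | y in Y].

Definition dist (R : realType) (k : nat) (a : 'rV[R]_k) (B : set 'rV[R]_k) : R :=
  inf [set enorm (a - b) | b in B].

Definition excess (R : realType) (k : nat) (A B : set 'rV[R]_k) : \bar R :=
  ereal_sup [set (dist a B)%:E | a in A].

Definition far_set (R : realType) (k : nat) (X : set 'rV[R]_k)
    (g : 'rV[R]_k -> R) (tau : R) : set 'rV[R]_k :=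
  [set x | X x /\ tau <= dist x (argmin X g)].

(* ereal_inf set0 = +oo accounts for the case where far_set X g tau is empty. *)
Definition growth (R : realType) (k : nat) (X : set 'rV[R]_k)
    (g : 'rV[R]_k -> R) (tau : R) : \bar R :=
  ereal_inf [set (g x - minof (g @` X))%:E | x in far_set X g tau].

Definition growth_inv (R : realType) (k : nat) (X : set 'rV[R]_k)
    (g : 'rV[R]_k -> R) (t : R) : \bar R :=
  ereal_sup [set tau%:E |
    tau in [set tau : R | 0 <= tau /\ (growth X g tau <= t%:E)%E]].

(* Main.v *)
(* Taylor's formula along segments with an L-Lipschitz gradient gives
   |f(x,z) - f(x,y) - <grad_y f(x,y), z - y>| <= L/2 |z - y|^2. The lower bound,
   with L < Lhat, makes every q(x, y_j) a minorant of V(x); the upper bound at a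
   maximizer y of f(x, .) and the sample point y_j nearest to it gives
   V(x) - q(x, y_j) <= (L + Lhat)/2 |y - y_j|^2 <= Lhat beta^2. All extrema are
   attained because V, V_N and minus the distance to the sample are attained
   suprema of continuous functions on compact sets, hence have minimizers. *)
Require Import Defs.
From mathcomp Require Import all_boot all_order all_algebra.
From mathcomp Require Import all_classical all_reals all_analysis.
From mathcomp Require Import ring lra.

Set Implicit Arguments.
Unset Strict Implicit.
Unset Printing Implicit Defensive.

Import Order.TTheory GRing.Theory Num.Theory.
Import numFieldNormedType.Exports.

Local Open Scope classical_set_scope.
Local Open Scope ring_scope.

(** * Euclidean inner product and norm *)

Lemma dotpBZ (R : realType) (k : nat) (u v : 'rV[R]_k) (c : R) :
  dotp (u - c *: v) (u - c *: v) =
  dotp u u - 2 * c * dotp u v + c ^+ 2 * dotp v v.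
Proof.
rewrite /dotp !mulr_sumr -sumrB -big_split/=.
by apply: eq_bigr => i _; rewrite !mxE; ring.
Qed.

Lemma dotp_ge0 (R : realType) (k : nat) (u : 'rV[R]_k) : 0 <= dotp u u.
Proof. by apply: sumr_ge0 => i _; rewrite -expr2 sqr_ge0. Qed.

Lemma enorm_ge0 (R : realType) (k : nat) (u : 'rV[R]_k) : 0 <= enorm u.
Proof. exact: sqrtr_ge0. Qed.

Lemma sqr_enorm (R : realType) (k : nat) (u : 'rV[R]_k) :
  enorm u ^+ 2 = dotp u u.
Proof. by rewrite sqr_sqrtr// dotp_ge0. Qed.

Lemma dotpBl (R : realType) (k : nat) (u v w : 'rV[R]_k) :
  dotp (u - v) w = dotp u w - dotp v w.
Proof.
by rewrite /dotp -sumrB; apply: eq_bigr => i _; rewrite !mxE mulrBl.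
Qed.

Lemma dotp_row_mx0 (R : realType) (n m : nat) (u : 'rV[R]_(n + m))
    (v : 'rV[R]_m) : dotp u (row_mx 0 v) = dotp (rsubmx u) v.
Proof.
rewrite /dotp big_split_ord/= big1 ?add0r => [|i _].
  by apply: eq_bigr => i _; rewrite row_mxEr mxE.
by rewrite row_mxEl mxE mulr0.
Qed.

Lemma enorm_row_mx0 (R : realType) (n m : nat) (v : 'rV[R]_m) :
  enorm (row_mx (0 : 'rV[R]_n) v) = enorm v.
Proof. by rewrite /enorm dotp_row_mx0 row_mxKr. Qed.

(** A Cauchy-Schwarz bound obtained without dividing by a norm: expanding |u - c v|^2 >= 0 and |u +
    c v|^2 >= 0 gives 2c |<u, v>| <= |u|^2 + c^2 |v|^2 <= 2 c^2 |v|^2, so v = 0 is not a special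
    case. *)
Lemma dotp_le_of_enorm_le (R : realType) (k : nat) (u v : 'rV[R]_k) (c : R) :
  0 < c -> enorm u <= c * enorm v -> `|dotp u v| <= c * dotp v v.
Proof.
move=> c0 uv.
have uu : dotp u u <= c ^+ 2 * dotp v v.
  by rewrite -!sqr_enorm -exprMn lerXn2r// nnegrE ?mulr_ge0 ?enorm_ge0 ?ltW.
have := dotp_ge0 (u - c *: v); have := dotp_ge0 (u - (- c) *: v).
rewrite !dotpBZ sqrrN => uNv uPv.
have c2 : 0 < 2 * c by rewrite mulr_gt0.
by rewrite ler_norml; apply/andP; split; rewrite -(ler_pM2l c2); lra.
Qed.

Lemma enormZ (R : realType) (k : nat) (c : R) (u : 'rV[R]_k) :
  0 <= c -> enorm (c *: u) = c * enorm u.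
Proof.
move=> c0; rewrite /enorm -[X in _ = X * _]ger0_norm// -sqrtr_sqr.
rewrite -sqrtrM ?sqr_ge0//; congr Num.sqrt; rewrite /dotp mulr_sumr.
by apply: eq_bigr => i _; rewrite !mxE; ring.
Qed.

(** * Continuity of finite sums and of row-vector-valued maps *)

Lemma continuous_sum (R : realType) (T : topologicalType) (I : Type)
    (r : seq I) (h : I -> T -> R) (x : T) :
  (forall i, {for x, continuous (h i)}) ->
  {for x, continuous (fun t => \sum_(i <- r) h i t)}.
Proof.
move=> ch; elim: r => [|i r IH]; rewrite /prop_for/=.
  by under eq_fun do rewrite big_nil; exact: cst_continuous.
by under eq_fun do rewrite big_cons; apply: continuousD => //; exact: ch.
Qed.

Lemma continuous_row (R : realType) (T : topologicalType) (k : nat)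
    (h : T -> 'rV[R]_k) (x : T) :
  (forall i, {for x, continuous (fun t => h t 0 i)}) -> {for x, continuous h}.
Proof.
move=> ch; apply/cvg_ballP => e e0.
(* Balls of the sup norm are coordinatewise, so it is enough to control finitely many coordinates
   simultaneously. *)
suff : \forall t \near x, forall i, `|h x 0 i - h t 0 i| < e.
  apply: filterS => t ht; split => // i j.
  by rewrite ord1 -ball_normE; exact: ht.
by apply: filter_forall => i; by have /cvgrPdist_lt := ch i; apply.
Qed.

(** * Attained extrema *)

Lemma maxof_spec (R : realType) (S : set R) (a : R) :
  S a -> ubound S a -> S (maxof S) /\ ubound S (maxof S).
Proof. by move=> Sa Ua; apply: (@xgetPex _ 0 (S `&` ubound S)); exists a. Qed.

(** Excludes the default 0 of [maxof]: once some greatest element is exhibited, antisymmetry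
    identifies the chosen one with it. *)
Lemma maxof_eq (R : realType) (S : set R) (a : R) :
  S a -> ubound S a -> maxof S = a.
Proof.
move=> Sa Ua; have [Sm Um] := maxof_spec Sa Ua.
by apply/eqP; rewrite eq_le Ua//= Um.
Qed.

Lemma minof_eq (R : realType) (S : set R) (a : R) :
  S a -> lbound S a -> minof S = a.
Proof.
move=> Sa La; have [Sm Lm] : (S `&` lbound S) (minof S).
  by apply: xgetPex; exists a.
by apply/eqP; rewrite eq_le La//= Lm.
Qed.

Lemma minof_argmin (R : realType) (k : nat) (X : set 'rV[R]_k)
    (g : 'rV[R]_k -> R) (x : 'rV[R]_k) : argmin X g x -> minof (g @` X) = g x.
Proof.
move=> [Xx gx]; apply: minof_eq; first by exists x.
by move=> _ [x' Xx' <-]; exact: gx.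
Qed.

Lemma ord_argmax (R : realType) (N : nat) (F : 'I_N -> R) :
  (0 < N)%N -> exists i, forall j, F j <= F i.
Proof.
move=> N0; case: (arg_maxP F (isT : predT (Ordinal N0))) => i _ H.
by exists i => j; exact: H.
Qed.

(* A pointwise supremum of continuous functions is lower semicontinuous; a
   cluster point of the sublevel sets of g is therefore a minimizer. *)
Lemma compact_min_sup (R : realType) (T : topologicalType) (I : Type)
    (A : set T) (J : set I) (h : I -> T -> R) (g : T -> R) :
  A !=set0 -> compact A ->
  (forall i x, J i -> A x -> {for x, continuous (h i)}) ->
  (forall i x, J i -> A x -> h i x <= g x) ->
  (forall x, A x -> exists2 i, J i & g x = h i x) ->
  exists2 x, A x & forall x', A x' -> g x <= g x'.
Proof.
move=> [a Aa] cA ch hg gh.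
pose B x' := [set x | A x /\ g x <= g x'].
have FF : Filter (filter_from A B).
  apply: filter_from_filter; first by exists a.
  move=> i j Ai Aj; have [ij|/ltW ji] := leP (g i) (g j).
    by exists i => // x [Ax xi]; split; split => //; exact: le_trans ij.
  by exists j => // x [Ax xi]; split; split => //; exact: le_trans ji.
have PF : ProperFilter (filter_from A B).
  by apply: filter_from_proper => x Ax; exists x; split.
have [|p [Ap cp]] := cA _ PF; first by exists a => // x [].
exists p => // x' Ax'; rewrite leNgt; apply/negP => gx'p.
(* If g x' < g p, the member [h i] attaining g p exceeds g x' on a neighbourhood of p. The sublevel
   set [B x'] meets that neighbourhood, which contradicts [h i] <= g there. *)
have [i Ji gpi] := gh _ Ap; rewrite gpi in gx'p.
have [x [[Ax xx']]] := cp _ _ (ex_intro2 _ _ x' Ax' (@subset_refl _ (B x')))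
  (cvgr_gt _ (ch i p Ji Ap) _ gx'p).
by rewrite /= ltNge (le_trans (hg _ _ Ji Ax) xx').
Qed.

(** * First-order Taylor estimate under a Lipschitz gradient *)

Lemma derive_grad (R : realType) (k : nat) (f : 'rV[R]_k -> R)
    (z v : 'rV[R]_k) : differentiable f z -> 'D_v f z = dotp (grad f z) v.
Proof.
move=> df; rewrite deriveE// {1}[v]row_sum_delta linear_sum.
by apply: eq_bigr => i _; rewrite linearZ/= mxE /partial deriveE// mulrC.
Qed.

(* MVT for t |-> f (p + t v) - t f'(p; v) - t^2 (K / 2) |v|^2 *)
Lemma MVT_quadratic (R : realType) (k : nat) (f : 'rV[R]_k -> R)
    (p v : 'rV[R]_k) (K : R) :
  (forall t, 0 <= t <= 1 -> differentiable f (p + t *: v)) ->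
  exists2 c, 0 < c < 1 &
    f (p + v) - f p - dotp (grad f p) v - K / 2 * dotp v v =
    dotp (grad f (p + c *: v) - grad f p) v - K * c * dotp v v.
Proof.
move=> df.
pose phi (t : R) := f (p + t *: v) - t * dotp (grad f p) v
                    - t ^+ 2 * (K / 2 * dotp v v).
pose dphi (t : R) := dotp (grad f (p + t *: v)) v - dotp (grad f p) v
                    - K * t * dotp v v.
have dline (t : R) : 0 <= t <= 1 ->
    is_derive t 1 (fun s => f (p + s *: v)) (dotp (grad f (p + t *: v)) v).
  move=> t01; have dft := df _ t01.
  (* The difference quotient of s |-> f (p + s v) at t is the quotient of f at p + t v in direction
     v, so both derivability and the value of the derivative transfer. *)
  have E : (fun h : R => h^-1 *: (f (p + (h *: 1 + t) *: v) - f (p + t *: v))) =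
           (fun h : R => h^-1 *: (f (h *: v + (p + t *: v)) - f (p + t *: v))).
    apply/funext => h; congr (_ *: (f _ - _)).
    by rewrite /GRing.scale/= mulr1 -/(GRing.scale _ _) scalerDl addrCA.
  split; first by rewrite /derivable/= E; exact: diff_derivable.
  by rewrite -derive_grad// /derive/= E.
have dphiP (t : R) : 0 <= t <= 1 -> is_derive t 1 phi (dphi t).
  rewrite /phi /dphi => /dline.
  move: (dotp (grad f (p + t *: v)) v) => D dl.
  by apply: is_derive_eq; rewrite /GRing.scale/=; field.
have [t| |c c01] := @MVT R phi dphi 0 1 ltr01.
- by rewrite in_itv/= => /andP[/ltW t0 /ltW t1]; apply: dphiP; rewrite t0.
- apply: derivable_within_continuous => t; rewrite in_itv/= => t01.
  by have [] := dphiP _ t01.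
rewrite /phi /dphi scale1r scale0r addr0 => E.
exists c; first by move: c01; rewrite in_itv.
by rewrite dotpBl; lra.
Qed.
(** The factor 1/2 comes from the mean value theorem alone, without integration: taking K = L makes
    the right-hand side of [MVT_quadratic] nonpositive, and K = - L makes it nonnegative, each at
    its own intermediate point. *)
Lemma descent (R : realType) (k : nat) (f : 'rV[R]_k -> R) (p v : 'rV[R]_k)
    (L : R) :
  0 < L ->
  (forall t, 0 <= t <= 1 -> differentiable f (p + t *: v)) ->
  (forall t, 0 < t < 1 ->
     enorm (grad f (p + t *: v) - grad f p) <= L * t * enorm v) ->
  `|f (p + v) - f p - dotp (grad f p) v| <= L / 2 * dotp v v.
Proof.
move=> L0 df lip.
have bnd c : 0 < c < 1 ->
    `|dotp (grad f (p + c *: v) - grad f p) v| <= L * c * dotp v v.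
  move=> /[dup] c01 /andP[c0 _].
  by apply: dotp_le_of_enorm_le; [exact: mulr_gt0 | exact: lip].
have [c /bnd cb Ec] := MVT_quadratic L df.
have [d /bnd db Ed] := MVT_quadratic (- L) df.
move: cb db; rewrite !ler_norml => /andP[_ cb] /andP[db _].
by apply/andP; split; lra.
Qed.

Lemma convex_segment (R : realType) (m : nat) (Y : set 'rV[R]_m)
    (y z : 'rV[R]_m) (t : R) :
  convex_set Y -> Y y -> Y z -> 0 <= t <= 1 -> Y (y + t *: (z - y)).
Proof.
move=> cY Yy Yz /andP[t0 t1].
(* z comes first because the convex combination gives its first point the weight t. *)
have := cY z y (Itv01 t0 t1); rewrite !inE => /(_ Yz Yy).
congr Y; rewrite /conv/= /unstable.onem scalerBl scale1r scalerBr.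
by rewrite addrC -addrA; congr (_ + _); rewrite addrC.
Qed.

(** [descent] along a direction whose x-block is zero: the segment stays over the fixed x, so
    convexity of Y keeps it in the domain, and pairing with the full gradient reduces to pairing
    with [grad_y]. *)
Lemma descent_y (R : realType) (n m : nat) (Y : set 'rV[R]_m)
    (f : 'rV[R]_(n + m) -> R) (L : R) (x : 'rV[R]_n) (y z : 'rV[R]_m) :
  convex_set Y -> 0 < L ->
  (forall y, Y y -> differentiable f (row_mx x y)) ->
  (forall y y', Y y -> Y y' ->
     enorm (grad f (row_mx x y) - grad f (row_mx x y'))
       <= L * enorm (row_mx x y - row_mx x y')) ->
  Y y -> Y z ->
  `|f (row_mx x z) - f (row_mx x y) - dotp (grad_y f x y) (z - y)|
    <= L / 2 * enorm (z - y) ^+ 2.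
Proof.
move=> cY L0 df lip Yy Yz.
pose p := row_mx x y; pose v : 'rV[R]_(n + m) := row_mx 0 (z - y).
have pvE t : p + t *: v = row_mx x (y + t *: (z - y)).
  by rewrite scale_row_mx scaler0 add_row_mx addr0.
have Yt t : 0 <= t <= 1 -> Y (y + t *: (z - y)) by exact: convex_segment.
have pv : p + v = row_mx x z by rewrite add_row_mx addr0 addrC subrK.
have := @descent _ _ f p v L L0; rewrite pv dotp_row_mx0.
rewrite -[dotp v v]sqr_enorm enorm_row_mx0; apply => t t01.
  by rewrite pvE; apply: df; exact: Yt.
have /andP[t0 t1] := t01.
rewrite pvE; apply: le_trans (lip _ _ _ Yy) _; first by apply: Yt; lra.
rewrite -pvE addrAC subrr add0r enormZ; last exact: ltW.
by rewrite enorm_row_mx0 mulrA.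
Qed.

(** * Continuity of norms, partial maps and gradients *)

Lemma continuous_dotp (R : realType) (T : topologicalType) (k : nat)
    (g h : T -> 'rV[R]_k) (x : T) :
  {for x, continuous g} -> {for x, continuous h} ->
  {for x, continuous (fun t => dotp (g t) (h t))}.
Proof.
move=> cg ch; apply: continuous_sum => i; apply: continuousM.
  exact: (continuous_comp cg (@coord_continuous _ _ _ 0 i _)).
exact: (continuous_comp ch (@coord_continuous _ _ _ 0 i _)).
Qed.

Lemma continuous_enorm (R : realType) (T : topologicalType) (k : nat)
    (h : T -> 'rV[R]_k) (x : T) :
  {for x, continuous h} -> {for x, continuous (fun t => enorm (h t))}.
Proof.
move=> ch; apply: (@continuous_comp _ _ _ (fun t => dotp (h t) (h t)) Num.sqrt).
  exact: continuous_dotp.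
exact: sqrt_continuous.
Qed.

Lemma continuous_row_mxl (R : realType) (n m : nat) (y : 'rV[R]_m) :
  continuous (fun x : 'rV[R]_n => row_mx x y).
Proof.
move=> x; apply: continuous_row => i; rewrite /prop_for/=.
under eq_fun do rewrite mxE.
by case: (fintype.split i) => j;
  [exact: coord_continuous | exact: cst_continuous].
Qed.

Lemma continuous_row_mxr (R : realType) (n m : nat) (x : 'rV[R]_n) :
  continuous (fun y : 'rV[R]_m => row_mx x y).
Proof.
move=> y; apply: continuous_row => i; rewrite /prop_for/=.
under eq_fun do rewrite mxE.
by case: (fintype.split i) => j;
  [exact: cst_continuous | exact: coord_continuous].
Qed.

Lemma continuous_grad (R : realType) (k : nat) (f : 'rV[R]_k -> R)
    (z : 'rV[R]_k) :
  (forall i, {for z, continuous (partial i f)}) ->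
  {for z, continuous (grad f)}.
Proof.
move=> cf; apply: continuous_row => i; rewrite /prop_for/=.
by under eq_fun do rewrite mxE; exact: cf.
Qed.

Lemma continuous_rsubmx (R : realType) (n m : nat) :
  continuous (@rsubmx R 1 n m).
Proof.
move=> z; apply: continuous_row => i; rewrite /prop_for/=.
by under eq_fun do rewrite mxE; exact: coord_continuous.
Qed.

(** * Attainment of the maxima in V, the coverage radius and q *)

Lemma maxof_attained (R : realType) (T : topologicalType) (A : set T)
    (g : T -> R) :
  A !=set0 -> compact A -> (forall x, A x -> {for x, continuous g}) ->
  exists2 x, A x & maxof (g @` A) = g x /\ forall x', A x' -> g x' <= g x.
Proof.
move=> A0 cA cg.
(* A maximizer of g is a minimizer of - g, seen as the supremum of a one-member family. *)
have [|||x Ax xmin] := @compact_min_sup R T unit A setT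
    (fun _ t => - g t) (fun t => - g t) A0 cA.
- by move=> _ x _ Ax; apply: continuousN; exact: cg.
- by [].
- by move=> x Ax; exists tt.
have gx x' : A x' -> g x' <= g x by move=> /xmin; rewrite lerN2.
exists x => //; split=> //; apply: maxof_eq; first by exists x.
by move=> _ [x' Ax' <-]; exact: gx.
Qed.

(** The outer maximum in [coverage_radius] must be attained for its value to be meaningful. Minus
    the distance to the sample is a maximum of finitely many continuous functions, so it has a
    minimizer z on Y, a point farthest from the sample. *)
Lemma coverage (R : realType) (m : nat) (Y : set 'rV[R]_m) (N : nat)
    (ys : 'I_N -> 'rV[R]_m) (y : 'rV[R]_m) :
  (0 < N)%N -> compact Y -> Y y ->
  exists j, enorm (y - ys j) <= coverage_radius Y ys.
Proof.
move=> N0 cY Yy.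
pose g y := minof (range (fun j => enorm (y - ys j))).
have gE z : exists2 j, g z = enorm (z - ys j) &
    forall i, g z <= enorm (z - ys i).
  have [j Hj] := ord_argmax (fun j => - enorm (z - ys j)) N0.
  suff gz : g z = enorm (z - ys j) by exists j => // i; rewrite gz -lerN2.
  apply: minof_eq; first by exists j.
  by move=> _ [i _ <-]; rewrite -lerN2.
have [|||z Yz zmin] := @compact_min_sup R _ 'I_N Y setT
    (fun j y => - enorm (y - ys j)) (fun y => - g y) (ex_intro _ y Yy) cY.
- move=> j x _ _; apply: continuousN; apply: continuous_enorm.
  by apply: continuousB; [exact: cvg_id | exact: cst_continuous].
- by move=> j x _ _; rewrite lerN2; have [? _] := gE x.
- by move=> x _; have [j gx _] := gE x; exists j => //; rewrite gx.
have -> : coverage_radius Y ys = g z.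
  apply: maxof_eq; first by exists z.
  by move=> _ [y' Yy' <-]; rewrite -lerN2; exact: zmin.
by have [j gy _] := gE y; exists j; rewrite -gy -lerN2; exact: zmin.
Qed.

(** Both directions of the main estimate use this: the maximizer turns an upper bound on q into a
    bound at one point, and its maximality bounds q from below by the objective at any chosen point
    of Y. *)
Lemma qmodel_attained (R : realType) (n m : nat) (f : 'rV[R]_(n + m) -> R)
    (Y : set 'rV[R]_m) (c : R) (x : 'rV[R]_n) (y : 'rV[R]_m) :
  Y !=set0 -> compact Y ->
  let h z := f (row_mx x y) +
    (dotp (grad_y f x y) (z - y) - c / 2 * enorm (z - y) ^+ 2) in
  exists2 z, Y z & qmodel f Y c x y = h z /\ forall z', Y z' -> h z' <= h z.
Proof.
move=> Y0 cY h.
have cB z : {for z, continuous (fun z : 'rV[R]_m => z - y)}.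
  by apply: continuousB; [exact: cvg_id | exact: cst_continuous].
have [|z Yz [qz zmax]] := maxof_attained (g := fun z : 'rV[R]_m =>
    dotp (grad_y f x y) (z - y) - c / 2 * enorm (z - y) ^+ 2) Y0 cY.
  move=> z _; apply: continuousB.
    by apply: continuous_dotp; [exact: cst_continuous | exact: cB].
  apply: continuousM; first exact: cst_continuous.
  by apply: continuousM; apply: continuous_enorm; exact: cB.
exists z => //; split; first by rewrite /qmodel qz.
by move=> z' Yz'; rewrite lerD2l; exact: zmax.
Qed.

(** * The sandwich bound and its effect on optimal values and minimizers *)

Theorem theorem1 (R : realType) (n m : nat)
    (X : set 'rV[R]_n) (Y : set 'rV[R]_m) (f : 'rV[R]_(n + m) -> R)
    (L L0 Lhat : R)
    (X0 : X !=set0) (Xcompact : compact X) (Xconvex : convex_set X)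
    (Y0 : Y !=set0) (Ycompact : compact Y) (Yconvex : convex_set Y)
    (fC2 : exists U : set 'rV[R]_(n + m),
       [/\ open U, forall x y, X x -> Y y -> U (row_mx x y) & C2_on U f])
    (L_gt0 : 0 < L) (L0_gt0 : 0 < L0)
    (grad_lip : forall x y x' y', X x -> Y y -> X x' -> Y y' ->
       enorm (grad f (row_mx x y) - grad f (row_mx x' y'))
         <= L * enorm (row_mx x y - row_mx x' y'))
    (hess_xy_lip : forall x y x' y', X x -> Y y -> X x' -> Y y' ->
       opnorm (hess_xy f x y - hess_xy f x' y')
         <= L0 * enorm (row_mx x y - row_mx x' y'))
    (grad_bound : forall x y, X x -> Y y -> enorm (grad f (row_mx x y)) <= L)
    (L_lt_Lhat : L < Lhat)
    (N : nat) (N_gt0 : (0 < N)%N)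
    (ys : 'I_N -> 'rV[R]_m) (ysY : forall j, Y (ys j)) :
  let V := value f Y in
  let VN := sampled_value f Y Lhat ys in
  let beta := coverage_radius Y ys in
  let nu := minof (V @` X) in
  let nuN := minof (VN @` X) in
  let XS := argmin X V in
  let XNS := argmin X VN in
  [/\ forall x, X x -> 0 <= V x - VN x <= Lhat * beta ^+ 2,
      0 <= nu - nuN <= Lhat * beta ^+ 2,
      XS !=set0 /\ XNS !=set0
    & (excess XNS XS <= growth_inv X V (Lhat * beta ^+ 2))%E].
Proof.
move=> V VN beta nu nuN XS XNS.
have [U [_ XYU [df dpf _]]] := fC2.
have dfXY x y : X x -> Y y -> differentiable f (row_mx x y).
  by move=> Xx Yy; apply: df; exact: XYU.
have cfx x y : X x -> Y y -> {for x, continuous (fun x => f (row_mx x y))}.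
  move=> Xx Yy; apply: (continuous_comp (@continuous_row_mxl _ _ _ y x)).
  by apply: differentiable_continuous; exact: dfXY.
have cfy x y : X x -> Y y -> {for y, continuous (fun y => f (row_mx x y))}.
  move=> Xx Yy; apply: (continuous_comp (@continuous_row_mxr _ _ _ x y)).
  by apply: differentiable_continuous; exact: dfXY.
have cgx x y : X x -> Y y -> {for x, continuous (fun x => grad_y f x y)}.
  move=> Xx Yy.
  apply: (@continuous_comp _ _ _ (fun x => grad f (row_mx x y)) rsubmx);
    last exact: continuous_rsubmx.
  apply: (continuous_comp (@continuous_row_mxl _ _ _ y x)).
  apply: continuous_grad => i; apply: differentiable_continuous.
  by apply: dpf; exact: XYU.
have VP x : X x ->
    exists2 y, Y y & V x = f (row_mx x y) /\
      forall y', Y y' -> f (row_mx x y') <= f (row_mx x y).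
  move=> Xx; exact: (maxof_attained Y0 Ycompact (fun y Yy => cfy x y Xx Yy)).
have taylor x y z : X x -> Y y -> Y z ->
    `|f (row_mx x z) - f (row_mx x y) - dotp (grad_y f x y) (z - y)|
      <= L / 2 * enorm (z - y) ^+ 2.
  move=> Xx; apply: descent_y => // [y' Yy'|y1 y2 Yy1 Yy2].
    exact: dfXY.
  exact: grad_lip.
have VNP x : exists2 j, VN x = qmodel f Y Lhat x (ys j) &
    forall i, qmodel f Y Lhat x (ys i) <= VN x.
  have [j Hj] := ord_argmax (fun j => qmodel f Y Lhat x (ys j)) N_gt0.
  suff VNx : VN x = qmodel f Y Lhat x (ys j) by exists j => // i; rewrite VNx.
  apply: maxof_eq; first by exists j.
  by move=> _ [i _ <-].
have sandwich x : X x -> 0 <= V x - VN x <= Lhat * beta ^+ 2.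
  move=> Xx; have [y Yy [Vx ymax]] := VP x Xx.
  rewrite subr_ge0; apply/andP; split.
    have [j -> _] := VNP x.
    have [z Yz [-> _]] := qmodel_attained f Lhat x (ys j) Y0 Ycompact.
    rewrite Vx; apply: le_trans (ymax _ Yz).
    have := taylor x _ z Xx (ysY j) Yz; rewrite ler_norml => /andP[lb _].
    (* Half of this term is the slack between the penalty Lhat/2 |z - y_j|^2 in q and the Taylor
       error L/2 |z - y_j|^2. *)
    have : 0 <= (Lhat - L) * enorm (z - ys j) ^+ 2.
      by rewrite mulr_ge0 ?sqr_ge0// subr_ge0 ltW.
    by lra.
  (* For the upper bound, y maximizes f(x, .) and y_j lies within beta of it; y itself is the test
     point in the inner maximum of q(x, y_j). *)
  have [j yj] := coverage ys N_gt0 Ycompact Yy.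
  have [_ _ /(_ j) qj] := VNP x.
  have [z Yz [qz /(_ _ Yy) zmax]] :=
    qmodel_attained f Lhat x (ys j) Y0 Ycompact.
  rewrite qz in qj.
  have := taylor x _ y Xx (ysY j) Yy; rewrite ler_norml => /andP[_ ub].
  (* Half of this term raises the factor (L + Lhat)/2, Taylor error plus penalty, to Lhat. *)
  have : 0 <= (Lhat - L) * enorm (y - ys j) ^+ 2.
    by rewrite mulr_ge0 ?sqr_ge0// subr_ge0 ltW.
  have : Lhat * enorm (y - ys j) ^+ 2 <= Lhat * beta ^+ 2.
    rewrite ler_pM2l ?(lt_trans L_gt0)// lerXn2r// nnegrE ?enorm_ge0//.
    (* beta is nonnegative because it dominates a norm. *)
    exact: le_trans (enorm_ge0 _) yj.
  by lra.
have [x Xx xmin] : exists2 x, X x & forall x', X x' -> V x <= V x'.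
  apply: (compact_min_sup (J := Y) (h := fun y x => f (row_mx x y))
    X0 Xcompact).
  - by move=> y x Yy Xx; exact: cfx.
  - by move=> y x Yy /VP[y' _ [-> ]]; exact.
  - by move=> x /VP[y Yy [Vx _]]; exists y.
have [xN XxN xNmin] : exists2 x, X x & forall x', X x' -> VN x <= VN x'.
  (* Each q(., y_j) is itself a maximum over z, so V_N is treated as one supremum over pairs (j, z)
     of functions continuous in x. *)
  apply: (compact_min_sup (J := [set jz : 'I_N * 'rV[R]_m | Y jz.2])
    (h := fun jz x => f (row_mx x (ys jz.1)) +
      (dotp (grad_y f x (ys jz.1)) (jz.2 - ys jz.1)
       - Lhat / 2 * enorm (jz.2 - ys jz.1) ^+ 2)) X0 Xcompact).
  - move=> [j z] t /= Yz Xt; apply: continuousD; first exact: cfx.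
    apply: continuousB; last exact: cst_continuous.
    by apply: continuous_dotp; [exact: cgx | exact: cst_continuous].
  - move=> [j z] t /= Yz Xt; have [_ _ /(_ j)] := VNP t; apply: le_trans.
    have [z' _ [-> ]] := qmodel_attained f Lhat t (ys j) Y0 Ycompact.
    exact.
  - move=> t Xt; have [j VNt _] := VNP t.
    have [z Yz [qz _]] := qmodel_attained f Lhat t (ys j) Y0 Ycompact.
    by exists (j, z) => //; rewrite VNt qz.
have nuE : nu = V x by apply: minof_argmin; split.
have nuNE x' : XNS x' -> nuN = VN x' by exact: minof_argmin.
have VN_le x' : X x' -> VN x' <= V x'.
  by move=> /sandwich /andP[]; rewrite subr_ge0.
have gap x' : X x' -> V x' - VN x' <= Lhat * beta ^+ 2.
  by move=> /sandwich /andP[].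
split => //.
(* Each minimizer is tested in the other problem: [VN xN] <= [VN x] <= [V x] gives the sign, and
   [V x] <= [V xN] reduces the upper bound to the gap at [xN]. *)
- rewrite nuE (nuNE xN)// subr_ge0 (le_trans (xNmin _ Xx) (VN_le _ Xx))/=.
  exact: le_trans (lerB (xmin _ XxN) (lexx _)) (gap _ XxN).
- by split; [exists x | exists xN].
apply: ge_ereal_sup => _ [a XNa <-].
(* The distance of a to the solution set is itself an admissible tau, since a belongs to the
   corresponding [far_set]. *)
apply: ereal_sup_ubound; exists (dist a XS) => //; split.
  (* Nonnegativity of this infimum is derived from a nonempty set of distances, which the minimizer
     x provides. *)
  apply: lb_le_inf; first by exists (enorm (a - x)), x.
  by move=> _ [b _ <-]; exact: enorm_ge0.
have [Xa amin] := XNa.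
apply: (@le_trans _ _ (V a - nu)%:E).
  by apply: ereal_inf_lbound; exists a => //; split.
rewrite lee_fin nuE; apply: le_trans (gap _ Xa).
(* Optimality of a gives [VN a] <= [VN x] <= [V x], so the excess value of a is at most its gap
   [V a - VN a]. *)
exact: lerB (lexx _) (le_trans (amin _ Xx) (VN_le _ Xx)).
Qed.
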